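(* There is a data structure that maintains, for a dynamic finite point set $S\subset\mathbb{R}$ (undergoing point insertions and deletions), a near-perfect matching on $S$ of weight $O(\log|S|)\cdot\mathrm{diam}(S)$ such that each point insertion or deletion incurs $O(\log^2|S|)$ edge deletions and insertions in the matching.
   Context: A near-perfect matching on $S$ is a matching covering all but at most one point of $S$. Its weight is the sum of $|a-b|$ over matched pairs $\{a,b\}$; $\mathrm{diam}(S)=\max S-\min S$. *)

(* Defs.v *)
From mathcomp Require Import all_boot all_order all_algebra finmap.
From mathcomp Require Import reals.

Set Implicit Arguments.
Unset Strict Implicit.
Unset Printing Implicit Defensive.

Import Order.TTheory GRing.Theory Num.Theory.

Local Open Scope fset_scope.
Local Open Scope ring_scope.

(* The unordered edge {a, b} is encoded as the pair (a, b) with a < b, so that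
   every edge has exactly one code and set differences count edges. *)
Definition edge (R : realType) := (R * R)%type.

Definition endpoints (R : realType) (e : edge R) : {fset R} :=
  [fset e.1; e.2].

Definition matching_on (R : realType) (S : {fset R}) (M : {fset edge R}) :=
  (forall e, e \in M -> e.1 < e.2 /\ endpoints e `<=` S) /\
  (forall e f, e \in M -> f \in M -> e != f ->
     [disjoint endpoints e & endpoints f]).

Definition covered (R : realType) (M : {fset edge R}) : {fset R} :=
  \bigcup_(e <- M) endpoints e.

Definition near_perfect_matching (R : realType) (S : {fset R})
    (M : {fset edge R}) :=
  matching_on S M /\ (#|` S `\` covered M | <= 1)%N.

Definition weight (R : realType) (M : {fset edge R}) : R :=
  \sum_(e <- M) `|e.1 - e.2|.

(* max S - min S; the starting value of the folds is an element of S, unless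
   S is empty, in which case the diameter is 0. *)
Definition diam (R : realType) (S : {fset R}) : R :=
  let x0 := head 0 (enum_fset S) in
  \big[Num.max/x0]_(x <- S) x - \big[Num.min/x0]_(x <- S) x.

Definition edge_changes (R : realType) (M M' : {fset edge R}) : nat :=
  (#|` M `\` M'| + #|` M' `\` M|)%N.

(* The next state depends only on the current state and the requested update:
   the matching is maintained online, without knowledge of later updates. *)
Record dynamic_matching (R : realType) := DynamicMatching {
  state : Type;
  empty : state;
  insert : R -> state -> state;
  delete : R -> state -> state;
  matching : state -> {fset edge R} }.

(* [reaches S s]: some sequence of updates turning the empty point set into
   S, each inserting a new point or deleting a present one, drives D to s. *)
Inductive reaches (R : realType) (D : dynamic_matching R) :
    {fset R} -> state D -> Prop :=
  | reaches_empty : reaches fset0 (empty D)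
  | reaches_insert S s p :
      reaches S s -> p \notin S -> reaches (p |` S) (insert p s)
  | reaches_delete S s p :
      reaches S s -> p \in S -> reaches (S `\ p) (delete p s).

(* Main.v *)
(** Keep the points at the leaves of an AVL tree.  Every subtree leaves at most
    one of its points free, and a node matches the free points of its two
    children with each other when both have one.  The subtrees of a given depth
    span disjoint intervals, so each of the O(log n) levels contributes weight
    at most diam S.  An update changes the tree only along one root-to-leaf
    path, up to rotations, and each node of this path accounts for O(1) edges;
    the number of changed edges is therefore even O(log n). *)
Require Import Defs.
From mathcomp Require Import all_boot all_order all_algebra finmap.
From mathcomp Require Import reals exp.
From mathcomp Require Import zify lra.

Set Implicit Arguments.
Unset Strict Implicit.
Unset Printing Implicit Defensive.

Import Order.TTheory GRing.Theory Num.Theory.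

Local Open Scope fset_scope.
Local Open Scope ring_scope.

(** * Change counts, covered points, matchings and weights of edge sets *)

Section EdgeSets.
Variable R : realType.
Implicit Types (A B C : {fset edge R}) (S : {fset R}).

Lemma leq_cardfsU (T : choiceType) (X Y : {fset T}) :
  (#|` X `|` Y| <= #|` X| + #|` Y|)%N.
Proof. by rewrite cardfsU leq_subr. Qed.

Lemma edge_changes_refl A : edge_changes A A = 0%N.
Proof. by rewrite /edge_changes fsetDv cardfs0. Qed.

Lemma edge_changes_trans B A C :
  (edge_changes A C <= edge_changes A B + edge_changes B C)%N.
Proof.
have sub (X Y Z : {fset edge R}) :
    (#|` X `\` Z| <= #|` X `\` Y| + #|` Y `\` Z|)%N.
  apply: leq_trans (leq_cardfsU _ _); apply: fsubset_leq_card.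
  by apply/fsubsetP => x; rewrite !inE; do !case: (x \in _).
have := sub A B C; have := sub C B A; rewrite /edge_changes; lia.
Qed.

(** Lets changes be counted piece by piece: a piece common to both sides costs nothing by
    [edge_changes_refl]. *)
Lemma edge_changesU A A' B B' :
  (edge_changes (A `|` B) (A' `|` B') <=
     edge_changes A A' + edge_changes B B')%N.
Proof.
have sub (X X' Y Y' : {fset edge R}) :
    (#|` (X `|` Y) `\` (X' `|` Y')| <= #|` X `\` X'| + #|` Y `\` Y'|)%N.
  apply: leq_trans (leq_cardfsU _ _); apply: fsubset_leq_card.
  by apply/fsubsetP => x; rewrite !inE; do !case: (x \in _).
have := sub A A' B B'; have := sub A' A B' B; rewrite /edge_changes; lia.
Qed.

Lemma edge_changes_card A B : (edge_changes A B <= #|` A| + #|` B|)%N.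
Proof. by rewrite leq_add // fsubset_leq_card // fsubsetDl. Qed.

Lemma coveredP x A :
  reflect (exists2 e, e \in A & x \in endpoints e) (x \in covered A).
Proof.
apply: (iffP (bigfcupP _ _ _ _)) => -[e]; first by rewrite andbT; exists e.
by exists e; rewrite ?andbT.
Qed.

Lemma covered0 : covered (fset0 : {fset edge R}) = fset0.
Proof. by rewrite /covered big_seq_fset0. Qed.

Lemma covered1 (e : edge R) : covered [fset e] = endpoints e.
Proof. by rewrite /covered big_seq_fset1. Qed.

Lemma coveredU A B : covered (A `|` B) = covered A `|` covered B.
Proof.
apply/fsetP => x; rewrite inE; apply/coveredP/orP.
  by move=> [e]; rewrite inE => /orP[] eA xe; [left|right]; apply/coveredP;
    exists e.
by move=> [] /coveredP[e eA xe]; exists e => //; rewrite inE eA ?orbT.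
Qed.

Lemma matching_on0 S : matching_on S fset0.
Proof. by split. Qed.

(** Disjointness is asked of the covered points and not of [S] and [S'], so that an edge can be
    added to a matching on the same point set. *)
Lemma matching_onU S S' A B : matching_on S A -> matching_on S' B ->
  [disjoint covered A & covered B] -> matching_on (S `|` S') (A `|` B).
Proof.
move=> [edA disA] [edB disB] /fdisjointP dAB.
have dis e f : e \in A -> f \in B -> [disjoint endpoints e & endpoints f].
  move=> eA fB; apply/fdisjointP => x xe.
  have /dAB : x \in covered A by apply/coveredP; exists e.
  by apply: contraNN => xf; apply/coveredP; exists f.
split=> [e|e f]; rewrite !inE.
  case/orP => [/edA|/edB] [lt_e sub]; split=> //.
    exact: fsubset_trans sub (fsubsetUl _ _).
  exact: fsubset_trans sub (fsubsetUr _ _).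
case/orP => He /orP[] Hf; [exact: disA|move=> _|move=> _|exact: disB].
  exact: dis.
by rewrite fdisjoint_sym; exact: dis.
Qed.

Lemma weight0 : weight (fset0 : {fset edge R}) = 0.
Proof. by rewrite /weight big_seq_fset0. Qed.

Lemma weight1 (e : edge R) : weight [fset e] = `|e.1 - e.2|.
Proof. by rewrite /weight big_seq_fset1. Qed.

(** An edge common to [A] and [B] is counted only once on the left, and the terms are
    nonnegative. *)
Lemma weightU A B : weight (A `|` B) <= weight A + weight B.
Proof.
rewrite /weight (big_fsetID _ (mem A)) /= lerD //.
  rewrite le_eqVlt; apply/orP; left; apply/eqP; apply: eq_fbigl => e.
  by rewrite !inE andb_orl andbb; case: (e \in A); rewrite ?andbF.
rewrite [leRHS](big_fsetID _ (mem A)) /=.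
apply: ler_wpDl; first exact: sumr_ge0.
rewrite le_eqVlt; apply/orP; left; apply/eqP; apply: eq_fbigl => e.
by rewrite !inE; case: (e \in A); rewrite ?andbF.
Qed.

Lemma diam_ge S (x y : R) : x \in S -> y \in S -> y - x <= diam S.
Proof.
move=> xS yS; rewrite /diam; apply: lerB.
  exact: (@Order.TotalTheory.le_bigmax_seq _ _ _ _ _ y xpredT id yS isT).
exact: (@Order.TotalTheory.ge_bigmin_seq _ _ _ _ _ x xpredT id xS isT).
Qed.

End EdgeSets.

(** * Search trees with points at the leaves *)

Section Trees.
Variable R : realType.

(** There is no empty tree, so [first] and [final] are total. Inner nodes store no key; [first] of
    the right child guides the search. *)
Inductive tree := Leaf of R | Node of tree & tree.

Implicit Types (t l r : tree) (x y : R).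

Fixpoint points t : {fset R} :=
  if t is Node l r then points l `|` points r else
  if t is Leaf x then [fset x] else fset0.

Fixpoint height t : nat :=
  if t is Node l r then (maxn (height l) (height r)).+1 else 0.

Fixpoint first t : R :=
  match t with Leaf x => x | Node l _ => first l end.

Fixpoint final t : R :=
  match t with Leaf x => x | Node _ r => final r end.

Definition before (X Y : {fset R}) := forall x y, x \in X -> y \in Y -> x < y.

Fixpoint ordered t : Prop :=
  if t is Node l r then
    [/\ ordered l, ordered r & before (points l) (points r)]
  else True.

Fixpoint balanced t : bool :=
  if t is Node l r then
    [&& height l <= (height r).+1, height r <= (height l).+1,
        balanced l & balanced r]%N
  else true.

(** A point is left free exactly when the number of leaves is odd. *)
Fixpoint free t : option R :=
  match t with
  | Leaf x => Some x
  | Node l r =>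
    match free l, free r with
    | Some _, Some _ => None
    | None, o | o, None => o
    end
  end.

(** The left point is written first, which in an ordered tree gives the increasing code of the
    edge. *)
Definition cross l r : {fset edge R} :=
  match free l, free r with
  | Some x, Some y => [fset (x, y)]
  | _, _ => fset0
  end.

Fixpoint edges t : {fset edge R} :=
  if t is Node l r then cross l r `|` (edges l `|` edges r) else fset0.

(** The AVL rotations: single if the outer grandchild is at least as high as the inner one, double
    otherwise. The height tests exclude the [Leaf] cases, which only make the function total. *)
Definition balance l r : tree :=
  if ((height r).+1 < height l)%N then
    match l with
    | Node a b =>
      if (height b <= height a)%N then Node a (Node b r) else
      if b is Node b1 b2 then Node (Node a b1) (Node b2 r) else Node l r
    | Leaf _ => Node l r
    end
  else if ((height l).+1 < height r)%N then
    match r with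
    | Node a b =>
      if (height a <= height b)%N then Node (Node l a) b else
      if a is Node a1 a2 then Node (Node l a1) (Node a2 b) else Node l r
    | Leaf _ => Node l r
    end
  else Node l r.

Fixpoint add x t : tree :=
  match t with
  | Leaf y => if x < y then Node (Leaf x) (Leaf y) else Node (Leaf y) (Leaf x)
  | Node l r => if x < first r then balance (add x l) r
                else balance l (add x r)
  end.

(** [None] means that no point remains; the sibling then takes the place of the parent. A leaf is
    dropped without comparison, which is right when [x] is in the tree. *)
Fixpoint remove x t : option tree :=
  match t with
  | Leaf _ => None
  | Node l r =>
    if x < first r then
      if remove x l is Some l' then Some (balance l' r) else Some r
    else
      if remove x r is Some r' then Some (balance l r') else Some l
  end.

Lemma beforeUl X X' Y : before (X `|` X') Y <-> before X Y /\ before X' Y.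
Proof.
split=> [XY|[XY X'Y] x y]; last by rewrite inE => /orP[/XY|/X'Y]; apply.
by split=> x y xX; apply: XY; rewrite inE xX ?orbT.
Qed.

Lemma beforeUr X Y Y' : before X (Y `|` Y') <-> before X Y /\ before X Y'.
Proof.
split=> [XY|[XY XY'] x y xX]; last by rewrite inE => /orP[/XY|/XY']; apply.
by split=> x y xX yY; apply: XY; rewrite // inE yY ?orbT.
Qed.

Lemma before1l x Y : before [fset x] Y <-> forall y, y \in Y -> x < y.
Proof.
by split=> [xY y|xY z y]; [|rewrite inE => /eqP->]; apply: xY;
  rewrite ?inE.
Qed.

Lemma before1r X y : before X [fset y] <-> forall x, x \in X -> x < y.
Proof.
split=> [Xy x xX|Xy x z xX]; first by apply: Xy; rewrite ?inE.
by rewrite inE => /eqP->; apply: Xy.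
Qed.

Lemma before_sub X X' Y Y' :
  X `<=` X' -> Y `<=` Y' -> before X' Y' -> before X Y.
Proof. by move=> /fsubsetP sX /fsubsetP sY XY x y /sX xX /sY; apply: XY. Qed.

Lemma first_in t : first t \in points t.
Proof. by elim: t => [x|l IHl r _] /=; rewrite inE // IHl. Qed.

Lemma final_in t : final t \in points t.
Proof. by elim: t => [x|l _ r IHr] /=; rewrite inE // IHr orbT. Qed.

Lemma first_le t x : ordered t -> x \in points t -> first t <= x.
Proof.
elim: t => [y|l IHl r _] /=; first by rewrite inE => _ /eqP ->.
move=> [ol _ lr]; rewrite inE => /orP[/IHl|/(lr _ _ (first_in l))/ltW//].
exact.
Qed.

Lemma final_ge t x : ordered t -> x \in points t -> x <= final t.
Proof.
elim: t => [y|l _ r IHr] /=; first by rewrite inE => _ /eqP ->.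
move=> [_ ordr lr]; rewrite inE => /orP[xl|/IHr]; last exact.
by apply/ltW/lr => //; exact: final_in.
Qed.

Lemma free_in t x : free t = Some x -> x \in points t.
Proof.
elim: t x => [y|l IHl r IHr] x /=; first by case=> ->; rewrite inE.
rewrite inE; case: (free l) IHl => [y|] IHl; case: (free r) IHr => [z|] IHr //.
  by move=> /IHl ->.
by move=> /IHr ->; rewrite orbT.
Qed.

(** * The matching carried by a tree and its weight *)

Lemma disjoint_points l r : ordered (Node l r) ->
  [disjoint points l & points r].
Proof.
move=> [_ _ lr]; apply/fdisjointP => x xl; apply/negP => /(lr _ _ xl).
by rewrite ltxx.
Qed.

(** Both claims go through one induction: knowing exactly which points the children cover shows that
    the cross edge meets none of their edges. *)
Lemma edges_spec t : ordered t ->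
  matching_on (points t) (edges t) /\
  covered (edges t) = [fset x in points t | Some x != free t].
Proof.
elim: t => [x _|l IHl r IHr].
  split; first exact: matching_on0.
  apply/fsetP => y; rewrite covered0 !inE /= (inj_eq Some_inj).
  by case: eqVneq.
move=> olr; have dlr := disjoint_points olr.
move: olr => /= [/IHl[ml cl] /IHr[mr cr] lr].
have mU : matching_on (points l `|` points r) (edges l `|` edges r).
  apply: matching_onU => //; rewrite cl cr.
  apply: fdisjointWl (fset_sub _ _) _; rewrite fdisjoint_sym.
  by apply: fdisjointWl (fset_sub _ _) _; rewrite fdisjoint_sym.
have [fl fr] := (@free_in l, @free_in r).
rewrite !coveredU cl cr /cross.
case El : (free l) fl => [x|] fl; case Er : (free r) fr => [y|] fr;
  rewrite ?covered0 ?fset0U; split => //;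
  last by apply/fsetP => z; rewrite !inE !andbT.
(* The point set is doubled to match [matching_onU], with the cross edge and the rest both living on
   all of it. *)
- rewrite -[points l `|` points r]fsetUid; apply: matching_onU => //.
    split=> [e|e f]; rewrite !inE; last by move=> /eqP-> /eqP->; rewrite eqxx.
    move=> /eqP-> /=; split; first by apply: lr; [exact: fl|exact: fr].
    by apply/fsubsetP => z; rewrite !inE => /orP[] /eqP->;
      rewrite ?(fl _ erefl) ?(fr _ erefl) ?orbT.
  rewrite covered1 coveredU cl cr El Er.
  apply/fdisjointP => z; rewrite !inE !(inj_eq Some_inj) /=.
  have xr : x \notin points r by move/fdisjointP: dlr; apply; exact: fl.
  have yl : y \notin points l.
    by move: dlr; rewrite fdisjoint_sym => /fdisjointP; apply; exact: fr.
  by case/orP => /eqP->; rewrite eqxx ?(negPf xr) ?(negPf yl) !andbF.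
- rewrite covered1; apply/fsetP => z; rewrite !inE /= !(inj_eq Some_inj) andbT.
  case: (eqVneq z x) => [->|_]; first by rewrite (fl _ erefl).
  case: (eqVneq z y) => [->|_]; first by rewrite (fr _ erefl) !orbT.
  by rewrite !andbT.
- apply/fsetP => z; rewrite !inE /= !(inj_eq Some_inj) andbT.
  case: (eqVneq z x) => [->|_]; rewrite ?andbT ?andbF //=.
  by apply/negbTE; move/fdisjointP: dlr; apply; exact: fl.
- apply/fsetP => z; rewrite !inE /= !(inj_eq Some_inj) andbT.
  case: (eqVneq z y) => [->|_]; rewrite ?andbT ?andbF ?orbF //=.
  by apply/negbTE; move: dlr; rewrite fdisjoint_sym => /fdisjointP; apply;
    exact: fr.
Qed.

Lemma near_perfect_edges t : ordered t ->
  near_perfect_matching (points t) (edges t).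
Proof.
move=> /edges_spec[m c]; split=> //; rewrite c.
case Ef : (free t) => [x|]; last first.
  rewrite (_ : _ `\` _ = fset0) ?cardfs0 //.
  by apply/fsetP => y; rewrite !inE andbT andNb.
rewrite -(cardfs1 x); apply: fsubset_leq_card; apply/fsubsetP => y.
rewrite !inE (inj_eq Some_inj) negb_and negbK.
by case/andP => /orP[/negPf->|].
Qed.

Lemma weight_cross l r : ordered (Node l r) ->
  weight (cross l r) <= final r - first l.
Proof.
move=> [ol or lr]; have [fl fr] := (@free_in l, @free_in r).
have d_ge0 : 0 <= final r - first l.
  by rewrite subr_ge0; apply/ltW/lr; [exact: first_in|exact: final_in].
rewrite /cross; case El : (free l) fl => [x|] fl; rewrite ?weight0 //.
case Er : (free r) fr => [y|] fr; rewrite ?weight0 //.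
rewrite weight1 /= ltr0_norm ?subr_lt0 ?opprB.
  by apply: lerB; [apply: final_ge; auto|apply: first_le; auto].
by apply: lr; auto.
Qed.

(** The children span disjoint intervals inside that of the node, so their spreads add up to at most
    the whole; the cross edge pays for the extra level. *)
Lemma weight_edges t : ordered t ->
  weight (edges t) <= (height t)%:R * (final t - first t).
Proof.
elim: t => [x|l IHl r IHr] olr; first by rewrite /= weight0 mul0r.
have wc := weight_cross olr; move: olr => /= [ol or lr].
have fl : first l <= final l := first_le ol (final_in l).
have fr : first r <= final r := first_le or (final_in r).
have gap := lr _ _ (final_in l) (first_in r).
(* Both heights are raised to their maximum to obtain a common factor. *)
have {}IHl : weight (edges l) <=
    (maxn (height l) (height r))%:R * (final l - first l).
  apply: le_trans (IHl ol) _.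
  by rewrite ler_wpM2r ?subr_ge0 // ler_nat leq_maxl.
have {}IHr : weight (edges r) <=
    (maxn (height l) (height r))%:R * (final r - first r).
  apply: le_trans (IHr or) _.
  by rewrite ler_wpM2r ?subr_ge0 // ler_nat leq_maxr.
apply: le_trans (weightU _ _) _.
rewrite -natr1 mulrDl mul1r addrC lerD //.
apply: le_trans (weightU _ _) _; apply: le_trans (lerD IHl IHr) _.
by rewrite -mulrDr ler_wpM2l //; lra.
Qed.

(** * Rotations, balance and height *)

Lemma card_cross l r : (#|` cross l r| <= 1)%N.
Proof.
by rewrite /cross; case: (free l) => [x|]; case: (free r) => [y|];
  rewrite ?cardfs0 ?cardfs1.
Qed.

Lemma points_balance l r : points (balance l r) = points l `|` points r.
Proof.
rewrite /balance; case: ifP => _.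
  case: l => [//|a b] /=; case: ifP => _ /=; first by rewrite fsetUA.
  by case: b => //= b1 b2; rewrite !fsetUA.
case: ifP => _ //.
case: r => [//|a b] /=; case: ifP => _ /=; first by rewrite fsetUA.
by case: a => //= a1 a2; rewrite !fsetUA.
Qed.

Lemma ordered_balance l r : ordered (Node l r) -> ordered (balance l r).
Proof.
rewrite /balance; case: ifP => _.
  case: l => [//|a b] /=; case: ifP => _ /=.
    by move=> [[? ? ?] ? /beforeUl[? ?]]; split=> //; apply/beforeUr.
  case: b => // b1 b2.
  move=> [[? [? ? ?] /beforeUr[? ?]] ? /beforeUl[? /beforeUl[? ?]]].
  by split=> //; apply/beforeUl; split; apply/beforeUr.
case: ifP => _ //.
case: r => [//|a b] /=; case: ifP => _ /=.
  by move=> [? [? ? ?] /beforeUr[? ?]]; split=> //; apply/beforeUl.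
case: a => // a1 a2.
move=> [? [[? ? ?] ? /beforeUl[? ?]] /beforeUr[/beforeUr[? ?] ?]].
by split=> //; apply/beforeUl; split; apply/beforeUr.
Qed.

(** A rotation keeps the subtrees below it and replaces at most three inner nodes, each with at most
    one cross edge: three edges out, three in. *)
Lemma edge_changes_balance l r :
  (edge_changes (edges (Node l r)) (edges (balance l r)) <= 6)%N.
Proof.
have swap (A B C X Y : {fset edge R}) : X = A `|` C -> Y = B `|` C ->
    (#|` A| <= 3)%N -> (#|` B| <= 3)%N -> (edge_changes X Y <= 6)%N.
  move=> -> -> hA hB; apply: leq_trans (edge_changesU _ _ _ _) _.
  rewrite edge_changes_refl addn0.
  by apply: leq_trans (edge_changes_card _ _) _; rewrite (leq_add hA hB).
have card3 a b c d e f : (#|` cross a b `|` cross c d `|` cross e f| <= 3)%N.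
  apply: leq_trans (leq_cardfsU _ _) _.
  apply: (@leq_add _ _ 2 1) (card_cross e f).
  apply: leq_trans (leq_cardfsU _ _) _.
  exact: leq_add (card_cross _ _) (card_cross _ _).
have card2 a b c d : (#|` cross a b `|` cross c d| <= 3)%N.
  by rewrite -[cross c d]fsetUid fsetUA card3.
have triv X : (edge_changes X X <= 6)%N by rewrite edge_changes_refl.
rewrite /balance; case: ifP => _.
  case: l => [//|a b]; case: ifP => _.
    apply: (swap (cross (Node a b) r `|` cross a b)
      (cross a (Node b r) `|` cross b r) (edges a `|` edges b `|` edges r));
      rewrite ?card2 //; apply/fsetP => e; rewrite !inE;
      do !case: (e \in _) => //.
  case: b => // b1 b2.
  apply: (swap (cross (Node a (Node b1 b2)) r `|` cross a (Node b1 b2)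
        `|` cross b1 b2)
      (cross (Node a b1) (Node b2 r) `|` cross a b1 `|` cross b2 r)
      (edges a `|` edges b1 `|` edges b2 `|` edges r));
    rewrite ?card3 //; apply/fsetP => e; rewrite !inE;
    do !case: (e \in _) => //.
case: ifP => _ //.
case: r => [//|a b]; case: ifP => _.
  apply: (swap (cross l (Node a b) `|` cross a b)
    (cross (Node l a) b `|` cross l a) (edges l `|` edges a `|` edges b));
    rewrite ?card2 //; apply/fsetP => e; rewrite !inE;
    do !case: (e \in _) => //.
case: a => // a1 a2.
apply: (swap (cross l (Node (Node a1 a2) b) `|` cross (Node a1 a2) b
      `|` cross a1 a2)
    (cross (Node l a1) (Node a2 b) `|` cross l a1 `|` cross a2 b)
    (edges l `|` edges a1 `|` edges a2 `|` edges b));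
  rewrite ?card3 //; apply/fsetP => e; rewrite !inE;
  do !case: (e \in _) => //.
Qed.

(** The constant is 2 + 6: the cross edge of the node may be replaced when its children change, and
    then a rotation may follow. *)
Lemma edge_changes_rebalance l l' r r' :
  (edge_changes (edges (Node l r)) (edges (balance l' r')) <=
     edge_changes (edges l) (edges l') + edge_changes (edges r) (edges r')
     + 8)%N.
Proof.
apply: leq_trans (edge_changes_trans (edges (Node l' r')) _ _) _.
rewrite -[8%N]/(2 + 6)%N addnA leq_add ?edge_changes_balance //.
apply: leq_trans (edge_changesU _ _ _ _) _; rewrite addnC leq_add //.
  exact: edge_changesU.
apply: leq_trans (edge_changes_card _ _) _.
exact: leq_add (card_cross _ _) (card_cross _ _).
Qed.

(** An update puts siblings at most two levels apart. A rotation may absorb a level, so the height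
    is exact only without one; that last clause is needed to keep the height change of an update
    within one level. *)
Lemma balanced_balance l r : balanced l -> balanced r ->
  (height l <= (height r).+2)%N -> (height r <= (height l).+2)%N ->
  [/\ balanced (balance l r),
      (maxn (height l) (height r) <= height (balance l r))%N,
      (height (balance l r) <= (maxn (height l) (height r)).+1)%N &
      (height l <= (height r).+1)%N -> (height r <= (height l).+1)%N ->
       height (balance l r) = (maxn (height l) (height r)).+1].
Proof.
rewrite /balance; case: ifP => H1.
  case: l H1 => [//|a b] /= H1 /and4P[H2 H3 ba bb] br H4 H5.
  case: ifP => H6 /=; first by rewrite ba bb br; split; lia.
  case: b bb H1 H2 H3 H4 H5 H6 => [|b1 b2] //=.
  by move=> /and4P[? ? b1b b2b] *; rewrite ba b1b b2b br; split; lia.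
case: ifP => H2 bl br H3 H4; last by rewrite /= bl br; split; lia.
case: r br H1 H2 H3 H4 => [//|a b] /= /and4P[H1 H2 ba bb] H3 H4 H5 H6.
case: ifP => H7 /=; first by rewrite bl ba bb; split; lia.
case: a ba H1 H2 H3 H4 H5 H6 H7 => [|a1 a2] //=.
by move=> /and4P[? ? a1b a2b] *; rewrite bl a1b a2b bb; split; lia.
Qed.

(** The squared form of a logarithmic height bound, which replaces the usual Fibonacci estimate by a
    direct induction. *)
Lemma card_points t : ordered t -> balanced t ->
  (2 ^ height t <= #|` points t| ^ 2)%N.
Proof.
elim: t => [x|l IHl r IHr] olr /=; first by rewrite cardfs1.
move=> /and4P[hlr hrl /IHl{}IHl /IHr{}IHr].
have /eqP dlr := disjoint_points olr; move: olr => [/IHl{}IHl /IHr{}IHr _].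
rewrite cardfsU dlr cardfs0 subn0.
move: (#|` points l|) (#|` points r|) IHl IHr => m n.
(* Here [p] counts the leaves of the lower child and [q] those of the higher one. The squares give
   3A, and the mixed term is at least twice the square of the smaller number, hence at least 2A. *)
have arith (p q A : nat) : (A <= p ^ 2 -> 2 * A <= q ^ 2 ->
    2 * (2 * A) <= (p + q) ^ 2)%N.
  by move=> hp hq; case: (leqP p q) => pq; nia.
rewrite (expnS 2); have [lt_lr|lt_rl|<-] := ltngtP (height l) (height r).
- have <- : (height l).+1 = height r by lia.
  by rewrite (expnS 2); exact: arith.
- have <- : (height r).+1 = height l by lia.
  by rewrite (expnS 2) addnC => ? ?; exact: arith.
- by nia.
Qed.

(** * Insertion and deletion *)

Lemma add_spec x t : ordered t -> balanced t -> x \notin points t ->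
  [/\ points (add x t) = x |` points t,
      ordered (add x t),
      balanced (add x t),
      (height t <= height (add x t) <= (height t).+1)%N &
      (edge_changes (edges t) (edges (add x t)) <= 8 * height t + 1)%N].
Proof.
elim: t => [y _ _|l IHl r IHr] /=.
  rewrite inE => neq_xy.
  (* The [+ 1] of the bound: splitting a leaf, of height 0, creates one edge. *)
  have e0 l r : (edge_changes fset0 (cross l r `|` (fset0 `|` fset0)) <= 1)%N.
    rewrite !fsetU0; apply: leq_trans (edge_changes_card _ _) _.
    by rewrite cardfs0 card_cross.
  case: ltgtP neq_xy => // xy _; split=> //=; rewrite ?e0 //.
  - by split=> //; apply/before1l => z; rewrite inE => /eqP->.
  - by rewrite fsetUC.
  - by split=> //; apply/before1l => z; rewrite inE => /eqP->.
move=> [ol or lr] /and4P[hlr hrl bl br]; rewrite inE negb_or => /andP[xl xr].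
case: ltP => cmp.
  have {IHl} [pa oa ba /andP[h1 h2] ea] := IHl ol bl xl.
  have [|| bb h3 h4 h5] := balanced_balance ba br; [lia..|].
  split=> //; first by rewrite points_balance pa fsetUA.
  - apply: ordered_balance; split; rewrite // pa; apply/beforeUl; split=> //.
    by apply/before1l => y /(first_le or); exact: lt_le_trans.
  - by lia.
  apply: leq_trans (edge_changes_rebalance _ _ _ _) _.
  by rewrite edge_changes_refl; lia.
have {IHr} [pa oa ba /andP[h1 h2] ea] := IHr or br xr.
have [|| bb h3 h4 h5] := balanced_balance bl ba; [lia..|].
split=> //; first by rewrite points_balance pa fsetUCA.
- apply: ordered_balance; split; rewrite // pa; apply/beforeUr; split=> //.
  apply/before1r => y yl; apply: lt_le_trans cmp.
  by apply: lr => //; exact: first_in.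
- by lia.
apply: leq_trans (edge_changes_rebalance _ _ _ _) _.
by rewrite edge_changes_refl; lia.
Qed.

(** No [+ 1] occurs here: with a leaf its parent vanishes too, and the one cross edge lost fits into
    the 8 charged to that parent. *)
Lemma remove_spec x t : ordered t -> balanced t -> x \in points t ->
  if remove x t is Some t' then
    [/\ points t' = points t `\ x,
        ordered t',
        balanced t',
        (height t' <= height t <= (height t').+1)%N &
        (edge_changes (edges t) (edges t') <= 8 * height t)%N]
  else t = Leaf x.
Proof.
elim: t => [y _ _|l IHl r IHr] /=; first by rewrite inE => /eqP->.
move=> [ol or lr] /and4P[hlr hrl bl br]; rewrite inE.
case: ltP => cmp xlr.
  have xr : x \notin points r.
    by apply/negP => /(first_le or); rewrite leNgt cmp.
  move: xlr; rewrite (negPf xr) orbF => xl.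
  move: (IHl ol bl xl); case: (remove x l) => [l'|El]; last first.
    rewrite {l IHl ol bl xl}El in hlr hrl lr *; split=> //=; [|lia|].
      by rewrite fsetDUl fsetDv fset0U mem_fsetD1.
    (* An empty set is put on the right as the counterpart of the lost cross edge. *)
    rewrite fset0U -[X in edge_changes _ X]fset0U.
    apply: leq_trans (edge_changesU _ _ _ _) _.
    rewrite edge_changes_refl addn0.
    apply: leq_trans (edge_changes_card _ _) _.
    by rewrite cardfs0 addn0; apply: leq_trans (card_cross _ _) _; lia.
  move=> [pa oa ba /andP[h1 h2] ea].
  have [|| bb h3 h4 h5] := balanced_balance ba br; [lia..|].
  split=> //; first by rewrite points_balance pa fsetDUl (mem_fsetD1 xr).
  - apply: ordered_balance; split; rewrite // pa.
    by apply: before_sub lr => //; exact: fsubsetDl.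
  - by lia.
  apply: leq_trans (edge_changes_rebalance _ _ _ _) _.
  by rewrite edge_changes_refl; lia.
have xl : x \notin points l.
  apply/negP => xl; have := lr _ _ xl (first_in r).
  by rewrite ltNge cmp.
move: xlr; rewrite (negPf xl) /= => xr.
move: (IHr or br xr); case: (remove x r) => [r'|Er]; last first.
  rewrite {r IHr or br xr cmp}Er in hlr hrl lr *; split=> //=; [|lia|].
    by rewrite fsetDUl fsetDv fsetU0 mem_fsetD1.
  rewrite fsetU0 -[X in edge_changes _ X]fset0U.
  apply: leq_trans (edge_changesU _ _ _ _) _.
  rewrite edge_changes_refl addn0.
  apply: leq_trans (edge_changes_card _ _) _.
  by rewrite cardfs0 addn0; apply: leq_trans (card_cross _ _) _; lia.
move=> [pa oa ba /andP[h1 h2] ea].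
have [|| bb h3 h4 h5] := balanced_balance bl ba; [lia..|].
split=> //; first by rewrite points_balance pa fsetDUl (mem_fsetD1 xl).
- apply: ordered_balance; split; rewrite // pa.
  by apply: before_sub lr => //; exact: fsubsetDl.
- by lia.
apply: leq_trans (edge_changes_rebalance _ _ _ _) _.
by rewrite edge_changes_refl; lia.
Qed.

(** * From trees to the dynamic matching *)

Lemma card_points_gt0 t : (0 < #|` points t|)%N.
Proof.
by rewrite cardfs_gt0; apply/fset0Pn; exists (first t); exact: first_in.
Qed.

Lemma height_ln t : ordered t -> balanced t ->
  (height t)%:R * ln 2 <= 2 * ln (#|` points t|%:R : R).
Proof.
move=> ot bt; have := card_points ot bt; have n_gt0 := card_points_gt0 t.
rewrite -(ler_nat R) !natrX => le_n.
rewrite mulr_natl mulr_natl -!lnXn ?ltr0n //.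
by rewrite ler_ln // posrE exprn_gt0 // ltr0n.
Qed.

Definition tree_matching : dynamic_matching R :=
  DynamicMatching None
    (fun x s => Some (if s is Some t then add x t else Leaf x))
    (fun x s => if s is Some t then remove x t else None)
    (fun s => if s is Some t then edges t else fset0).

(** The invariant behind every update sequence, with [None] for the empty set; all bounds then
    concern a single tree or a single update. *)
Lemma reaches_tree S (s : state tree_matching) : reaches S s ->
  if s is Some t then [/\ S = points t, ordered t & balanced t] else S = fset0.
Proof.
elim=> {S s}[//|S [t|] x _ + xS|S [t|] x _ + xS] /=.
- move=> [ES ot bt]; rewrite ES in xS *.
  by have [-> ? ? _ _] := add_spec ot bt xS.
- by move=> ->; rewrite fsetU0.
- move=> [ES ot bt]; rewrite ES in xS *; have := remove_spec ot bt xS.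
  by case: (remove x t) => [t' [-> ? ? _ _]|->]; rewrite //= fsetDv.
- by move=> S0; rewrite S0 inE in xS.
Qed.

End Trees.

Theorem theorem7p1 (R : realType) :
  exists (D : dynamic_matching R) (C1 C2 : R),
    forall (S : {fset R}) (s : state D), reaches S s ->
      [/\ near_perfect_matching S (matching s),
          weight (matching s) <= C1 * ln (#|` S|%:R : R) * diam S,
          forall p : R, p \notin S ->
            (edge_changes (matching s) (matching (insert p s)))%:R
              <= C2 * ln (#|` p |` S|%:R : R) ^+ 2
        & forall p : R, p \in S ->
            (edge_changes (matching s) (matching (delete p s)))%:R
              <= C2 * ln (#|` S|%:R : R) ^+ 2].
Proof.
have ln2_gt0 : 0 < ln 2 :> R by rewrite ln_gt0 // ltr1n.
(* With a the binary logarithm of the size, the height is at most 2a. For a at least 1, the 8 edges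
   per level and the extra one give 16a + 1, at most 17 times the square of a. *)
exists (tree_matching R), (2 / ln 2), (17 / ln 2 ^+ 2) => S s /reaches_tree.
case: s => [t [-> ot bt]|->] /=; last first.
  split.
  - split; first exact: matching_on0.
    by rewrite covered0 fsetDv.
  - by rewrite weight0 (@ln0 _ 0) // mulr0 mul0r.
  (* The bound is 0 here, as [ln 1] vanishes; the first point indeed creates no edge. *)
  - by move=> p _; rewrite edge_changes_refl fsetU0 cardfs1 ln1 expr0n mulr0.
  - by move=> p; rewrite inE.
have h_ge0 : 0 <= (height t)%:R :> R := ler0n _ _.
have hln : (height t)%:R <= 2 / ln 2 * ln (#|` points t|%:R : R).
  by rewrite mulrAC ler_pdivlMr // height_ln.
(* Insertion takes [k] = 1 and the size after the update, deletion takes [k] = 0 and the size before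
   it. The condition [k < n] excludes an extra edge at [n] = 1, where the right side is 0. *)
have change_le (n k : nat) : (k <= 1)%N -> (k < n)%N ->
    (#|` points t| <= n)%N ->
    (8 * height t + k)%:R <= 17 / ln 2 ^+ 2 * ln (n%:R : R) ^+ 2.
  move=> k_le1 lt_kn le_n; have n_gt0 := leq_trans (card_points_gt0 t) le_n.
  (* The binary logarithm is made opaque, a plain variable for the arithmetic tactics. *)
  have [a Ea] : {a | a = ln n%:R / ln 2 :> R} by eexists.
  have h_le : (height t)%:R <= 2 * a.
    apply: le_trans hln _; rewrite Ea mulrAC mulrA ler_pM2r ?invr_gt0 //.
    rewrite ler_pM2l // ler_ln ?posrE ?ltr0n ?ler_nat //.
    exact: card_points_gt0.
  have -> : 17 / ln 2 ^+ 2 * ln (n%:R : R) ^+ 2 = 17 * a ^+ 2.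
    by rewrite Ea expr_div_n mulrAC -mulrA.
  rewrite natrD natrM.
  have [n1|n_gt1] : n = 1%N \/ (1 < n)%N by lia.
    have a0 : a = 0 by rewrite Ea n1 ln1 mul0r.
    have -> : k = 0%N by lia.
    by rewrite a0 in h_le *; lra.
  have a_ge1 : 1 <= a.
    by rewrite Ea ler_pdivlMr // mul1r ler_ln ?posrE ?ltr0n // ler_nat.
  have k_le : k%:R <= 1 :> R by rewrite (ler_nat _ k 1).
  by nra.
split.
- exact: near_perfect_edges.
- apply: le_trans (weight_edges ot) _.
  have d_ge0 : 0 <= final t - first t.
    by rewrite subr_ge0 (first_le ot (final_in t)).
  apply: le_trans (ler_wpM2r d_ge0 hln) _.
  apply: ler_wpM2l; first exact: le_trans hln.
  exact: diam_ge (first_in t) (final_in t).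
- move=> p pt; have [_ _ _ _ le_e] := add_spec ot bt pt.
  apply: (@le_trans _ _ (8 * height t + 1)%:R); first by rewrite ler_nat.
  apply: change_le; rewrite ?cardfsU1 ?pt ?leq_addl //.
  by rewrite add1n ltnS card_points_gt0.
- move=> p pt; have := remove_spec ot bt pt.
  (* Deleting the last point changes no edge. *)
  case: (remove p t) => [t' [_ _ _ _ le_e]|->]; last first.
    by rewrite edge_changes_refl mulr_ge0 ?sqr_ge0 ?divr_ge0 // exprn_ge0 ?ltW.
  apply: (@le_trans _ _ (8 * height t + 0)%:R); first by rewrite addn0 ler_nat.
  by apply: change_le; rewrite ?card_points_gt0.
Qed.
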